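(* Let $c$ be a positive real number and let $(G_k)$ be a family of finite groups whose orders tend to infinity. Suppose that for every $\varepsilon>0$ we have $f_{G_k}(c+\varepsilon) \to 0$ as $k \to \infty$. Then for every $\varepsilon > 0$, with probability tending to $1$ as $k\to\infty$, the diameter of $\Gamma \in \mathcal{G}\bigl(G_k, \sqrt{(c+\varepsilon)\log|G_k|/|G_k|}\bigr)$ is at most 2.
   Context: For a finite group $G$ and a subset $S \subseteq G$, the Cayley graph $\Gamma(G;S)$ has vertex set $G$ and an edge between distinct $g,h$ if and only if $hg^{-1} \in S$ or $gh^{-1} \in S$ (loops and multiple edges ignored). The random model $\mathcal{G}(G,p)$ is the probability space of graphs $\Gamma(G;S)$ where each element of $G$ is put in $S$ independently with probability $p$. The diameter of a disconnected graph is infinite. Dependency graphs: for a finite group $G$ and a non-identity $x \in G$, $\Gamma_x$ is the graph with vertex set $G$ in which $g$ is adjacent to $h$ iff $h \in \{xg, xg^{-1}, x^{-1}g, x^{-1}g^{-1}, gx, gx^{-1}, g^{-1}x, g^{-1}x^{-1}\}$; loops are allowed, multiple edges are ignored. For such a graph $\Gamma$, $\ell(\Gamma)$ is the number of loops and $e(\Gamma)$ the number of edges that are not loops. Write $n=|G|$. Define $g_G(x) = n^{-e(\Gamma_x)/n}$; $h_G(x) = \exp\bigl(-\sqrt{\tfrac{\log n}{n}}\,\ell(\Gamma_x)\bigr)$ if $x^2=1$ and $h_G(x) = \exp\bigl(-2\sqrt{\tfrac{\log n}{n}}\,\ell(\Gamma_x)\bigr)$ if $x^2\neq 1$; for $c>0$,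 $f_G(x;c) = g_G(x)^c h_G(x)^{\sqrt{c}}$ and $f_G(c) = \sum_{x \in G\setminus\{1\}} f_G(x;c)$. *)

(* Defs.v *)
From HB Require Import structures.
From mathcomp Require Export all_boot all_order all_algebra all_fingroup.
From mathcomp Require Export all_classical all_reals all_analysis.
Import Order.TTheory GRing.Theory Num.Theory.
Export numFieldNormedType.Exports.

Set Implicit Arguments.
Unset Strict Implicit.
Unset Printing Implicit Defensive.

Local Open Scope ring_scope.

Section Diameter.
Variables (R : realType) (T : finType) (e : rel T).

(* Equals +oo when no walk joins u to v. *)
Definition graph_dist (u v : T) : \bar R :=
  ereal_inf [set ((size p)%:R)%:E | p in [set p | path e u p /\ last u p = v]]%classic.

Definition diameter : \bar R :=
  ereal_sup [set graph_dist uv.1 uv.2 | uv in [set: T * T]]%classic.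

End Diameter.

Section CayleyGraph.
Variable gT : finGroupType.

Definition cayley_graph (S : {set gT}) : rel gT :=
  fun g h => (g != h) && ((h * g^-1 \in S) || (g * h^-1 \in S))%g.

Variable R : realType.

Definition subset_weight (p : R) (S : {set gT}) : R :=
  \prod_(g : gT) (if g \in S then p else 1 - p).

(* Probability of the graph property Q when each g is put in S independently
   with probability p; meaningful as a probability only for 0 <= p <= 1. *)
Definition cayley_prob (p : R) (Q : rel gT -> Prop) : R :=
  \sum_(S : {set gT} | `[< Q (cayley_graph S) >]) subset_weight p S.

End CayleyGraph.

Section DependencyGraph.
Variable gT : finGroupType.
Implicit Types x g h : gT.

(* A symmetric relation, with loops allowed. *)
Definition dep_graph x : rel gT := fun g h =>
  h \in [:: x * g; x * g^-1; x^-1 * g; x^-1 * g^-1;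
            g * x; g * x^-1; g^-1 * x; g^-1 * x^-1]%g.

Definition nloops (r : rel gT) : nat := #|[set g : gT | r g g]%SET|.

(* Non-loop edges, counted as unordered pairs. *)
Definition nedges (r : rel gT) : nat :=
  #|[set E : {set gT} |
      [exists g, exists h, [&& g != h, r g h & E == [set g; h]]]]%SET|.

Variable R : realType.

Local Notation n := (#|gT|%:R : R).

Definition dep_g x : R := n `^ (- ((nedges (dep_graph x))%:R / n)).

Definition dep_h x : R :=
  if (x ^+ 2 == 1)%g
  then expR (- (Num.sqrt (ln n / n) * (nloops (dep_graph x))%:R))
  else expR (- (2 * Num.sqrt (ln n / n) * (nloops (dep_graph x))%:R)).

Definition dep_f x (c : R) : R := dep_g x `^ c * dep_h x `^ Num.sqrt c.

Definition dep_f_sum (c : R) : R := \sum_(x : gT | x != 1%g) dep_f x c.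

End DependencyGraph.

(* Main.v *)
Require Import Defs.
From mathcomp Require Import fintype finset ring lra zify.
Import Order.TTheory GRing.Theory Num.Theory.
Set Implicit Arguments.
Unset Strict Implicit.
Unset Printing Implicit Defensive.
Local Open Scope classical_set_scope.
Local Open Scope ring_scope.

(* If the diameter exceeds 2, then S is an independent set of the dependency
   graph of some x <> 1 (loops being forbidden vertices).  These graphs have
   maximum degree at most 8, and deleting the vertices one at a time bounds the
   probability of independence by exp(-(1 - O(p)) (p^2 e + p l)), with e edges
   and l loops.  A union bound over x then compares with the sum of dep_f.

   For x^2 <> 1 this comparison is not termwise, because dep_h counts each loop
   twice.  The discrepancy matters only for the O(sqrt n) elements x with more
   than sqrt n loops, and for those it is enough that n^(-c e/n) is essentially
   at most n^(-1/2).  If a positive proportion of the group are involutions, whose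
   dependency graphs have at most 2n edges, the hypothesis on dep_f_sum forces
   c >= 1/2, while e >= n up to loops.  Otherwise a vertex g of degree less than
   4 satisfies, up to a negligible set, g^2 = x^2 with x^4 = 1; if a proportion
   zeta of the group does so, then e >= (2 - zeta) n, whereas the dependency
   graphs of these g have at most (4 - 2 zeta) n edges, which forces
   c (4 - 2 zeta) >= 1. *)

(** * Random subsets: product weights and independence of coordinates *)

Section RandomSubset.
Variables (R : realType) (T : finType) (p : R).
Hypothesis p01 : 0 <= p <= 1.
Implicit Types (S W D : {set T}) (E F : pred {set T}).

Definition weight S : R := \prod_(g : T) (if g \in S then p else 1 - p).

Definition pr E : R := \sum_(S | E S) weight S.

Lemma weight_ge0 S : 0 <= weight S.
Proof. by apply: prodr_ge0 => g _; case: ifP => _; move: p01; lra. Qed.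

Lemma pr_ge0 E : 0 <= pr E.
Proof. by apply: sumr_ge0 => S _; apply: weight_ge0. Qed.

Lemma eq_pr E F : E =1 F -> pr E = pr F.
Proof. by move=> EF; apply: eq_bigl. Qed.

Lemma pr_mono E F : subpred E F -> pr E <= pr F.
Proof.
move=> EF; rewrite /pr big_mkcond [leRHS]big_mkcond /=.
apply: ler_sum => S _; case: ifP => [/EF ->//|_].
by case: ifP => _ //; apply: weight_ge0.
Qed.

Lemma prT : pr predT = 1.
Proof.
rewrite /pr -(bigA_distr _ _ (fun=> p) (fun=> 1 - p)).
by rewrite big1 // => i _ /=; rewrite addrCA subrr addr0.
Qed.

Lemma pr_predC E : pr (predC E) = 1 - pr E.
Proof. by rewrite -prT /pr (bigID E predT) /= addrC addrK. Qed.

Lemma pr_union (I : finType) (P : pred I) (E : I -> pred {set T}) :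
  pr (fun S => [exists i, P i && E i S]) <= \sum_(i | P i) pr (E i).
Proof.
rewrite /pr (exchange_big_dep predT) //= big_mkcond /=.
apply: ler_sum => S _; case: ifP => [/existsP[i iP]|_].
  rewrite (bigD1 i) //= lerDl.
  by apply: sumr_ge0 => j _; apply: weight_ge0.
by apply: sumr_ge0 => j _; apply: weight_ge0.
Qed.

(** Written without division, so that [p = 1] is no special case. *)
Lemma weight_setU1 w S : w \notin S ->
  (1 - p) * weight (w |: S) = p * weight S.
Proof.
move=> wS; rewrite /weight (bigD1 w) //= [in RHS](bigD1 w) //=.
rewrite setU11 (negbTE wS) mulrCA; congr (_ * (_ * _)).
by apply: eq_bigr => g gw; rewrite in_setU1 (negbTE gw).
Qed.

(** The hypothesis says that [E] does not look at [w]. Adding [w] is then a bijection from the sets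
    of [E] without [w] to those with [w], and it changes weights in the ratio of [p] to [1 - p]. *)
Lemma pr_mem E w : (forall S, E (S :\ w) = E S) ->
  pr (fun S => E S && (w \in S)) = p * pr E.
Proof.
clear p01 => Ew; suff : (1 - p) * pr (fun S => E S && (w \in S)) =
    p * pr (fun S => E S && (w \notin S)).
  have : pr E = pr (fun S => E S && (w \in S)) + pr (fun S => E S && (w \notin S)).
    by rewrite /pr (bigID (fun S => w \in S)).
  by move=> -> h; lra.
rewrite /pr !big_distrr /=.
rewrite (reindex_onto (fun S => w |: S) (fun S => S :\ w)) /=; last first.
  by move=> S /andP[_ wS]; rewrite setD1K.
have eqP S : E (w |: S) && (w \in w |: S) && ((w |: S) :\ w == S) =
    E S && (w \notin S).
  rewrite setU11 andbT -(Ew (w |: S)).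
  have [wS|wS] := boolP (w \in S).
    by rewrite andbF; apply/andP => -[_ /eqP wSE]; move: wS; rewrite -wSE setD11.
  by rewrite setU1K // eqxx.
by rewrite (eq_bigl _ _ eqP); apply: eq_bigr => S /andP[_ /weight_setU1].
Qed.

Lemma pr_notin E w : (forall S, E (S :\ w) = E S) ->
  pr (fun S => E S && (w \notin S)) = (1 - p) * pr E.
Proof.
clear p01 => Ew; have := pr_mem Ew.
have : pr E = pr (fun S => E S && (w \in S)) + pr (fun S => E S && (w \notin S)).
  by rewrite /pr (bigID (fun S => w \in S)).
by move=> h1 h2; rewrite h1 in h2 *; lra.
Qed.

Lemma pr_disjoint E D : (forall w S, w \in D -> E (S :\ w) = E S) ->
  pr (fun S => E S && [disjoint S & D]) = (1 - p) ^+ #|D| * pr E.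
Proof.
have [m] := ubnP #|D|; elim: m D => // m IH D Dm ED.
have [->|[d dD]] := set_0Vmem D.
  rewrite cards0 expr0 mul1r; apply: eq_pr => S.
  by rewrite disjoint_sym disjoints_subset sub0set andbT.
have Dd : #|D| = #|D :\ d|.+1 by rewrite (cardsD1 d) dD.
rewrite Dd exprS -mulrA -IH; last 2 first.
- by move: Dm; rewrite Dd ltnS.
- by move=> w S; rewrite in_setD1 => /andP[_]; apply: ED.
rewrite -(@pr_notin _ d); last first.
  move=> S; rewrite ED //; congr (_ && _).
  rewrite !(disjoint_sym _ (mem (D :\ d))) !disjoints_subset.
  apply/subsetP/subsetP => h g gD; have := h g gD; rewrite !inE.
    by move: gD; rewrite !inE => /andP[->].
  by rewrite negb_and => ->; rewrite orbT.
apply: eq_pr => S /=; rewrite -andbA; congr (_ && _).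
rewrite !(disjoint_sym (mem S)) !disjoints_subset.
by rewrite -{1}(setD1K dD) subUset sub1set in_setC andbC.
Qed.

End RandomSubset.

(** * Probability that a random set is independent in a graph of degree at most 8 *)

Section IndependentSets.
Variables (R : realType) (T : finType) (r : rel T) (p : R).
Hypothesis p01 : 0 <= p <= 1.
Hypothesis r_sym : symmetric r.
Implicit Types (S W D : {set T}).

(** Only the part of [S] inside [W] is tested, so vertices can be deleted by shrinking [W] while [S]
    stays a random subset of [T]. The case [g = h] is included: a vertex of [W] with a loop must be
    avoided by [S]. *)
Definition indep W S :=
  [forall g in W, forall h in W, (g \in S) && (h \in S) ==> ~~ r g h].

Lemma indepP W S :
  reflect {in W & W, forall g h, g \in S -> h \in S -> ~~ r g h} (indep W S).
Proof.
apply: (iffP forall_inP) => [h g k gW kW gS kS|h g gW].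
  by have /forall_inP/(_ k kW) := h _ gW; rewrite gS kS.
by apply/forall_inP => k kW; apply/implyP => /andP[]; apply: h.
Qed.

Local Notation Z W := (pr p (indep W)).

Lemma indep_setD1 W w S : w \notin W -> indep W (S :\ w) = indep W S.
Proof.
move=> wW; have neq g : g \in W -> (g \in S :\ w) = (g \in S).
  by move=> gW; rewrite in_setD1; case: eqP gW wW => // -> ->.
by apply/indepP/indepP => h g k gW kW; have := h g k gW kW; rewrite !neq.
Qed.

Lemma indep_mono W W' S : W' \subset W -> indep W S -> indep W' S.
Proof.
by move=> /subsetP sW /indepP h; apply/indepP => g k /sW gW /sW; apply: h.
Qed.

Lemma pr_indep_mono W W' : W' \subset W -> Z W <= Z W'.
Proof. by move=> sW; apply: pr_mono => // S; apply: indep_mono. Qed.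

Definition nbrs W w := [set h in W | r w h]%SET.

Lemma pr_indep_disjoint W D : D \subset W ->
  pr p (fun S => indep W S && [disjoint S & D]) =
  (1 - p) ^+ #|D| * Z (W :\: D).
Proof.
move=> DW; rewrite -pr_disjoint; last first.
  by move=> w S wD; apply: indep_setD1; rewrite inE wD.
apply: eq_pr => S; have [SD|] := boolP [disjoint S & D]; last by rewrite !andbF.
rewrite !andbT; apply/idP/idP => [|/indepP h]; first exact/indep_mono/subsetDl.
have nD g : g \in S -> g \notin D.
  by move=> gS; apply: contraL SD => gD; apply/pred0Pn; exists g; rewrite /= gS.
by apply/indepP => g k gW kW gS kS; apply: h; rewrite // inE nD.
Qed.

(** Condition on [w]: if it is not chosen it imposes nothing, and if it is chosen then all its
    neighbours in [W] must be absent. *)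
Lemma pr_indep_setU1 W w : w \notin W -> ~~ r w w ->
  Z (w |: W) = (1 - p) * Z W + p * ((1 - p) ^+ #|nbrs W w| * Z (W :\: nbrs W w)).
Proof.
move=> wW rww; rewrite -pr_indep_disjoint; last by apply/subsetP => g; rewrite inE => /andP[].
rewrite -(@pr_notin _ _ _ (indep W) w); last by move=> S; apply: indep_setD1.
rewrite -(@pr_mem _ _ _ _ w); last first.
  move=> S; rewrite indep_setD1 //; congr (_ && _).
  rewrite !(disjoint_sym _ (mem (nbrs W w))) !disjoints_subset.
  apply/subsetP/subsetP => h g gD; have := h g gD; rewrite !inE.
    by case: eqP gD => [->|//]; rewrite inE (negbTE wW).
  by rewrite negb_and => ->; rewrite orbT.
rewrite [LHS]/pr (bigID (fun S => w \in S)) /= addrC; congr (_ + _).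
  apply: eq_bigl => S; rewrite andbC [RHS]andbC.
  have [//|wS] := boolP (w \in S); rewrite /=.
  apply/idP/idP => [|/indepP h]; first exact/indep_mono/subsetUr.
  apply/indepP => g k; rewrite !in_setU1 => /orP[/eqP->|gW].
    by rewrite (negbTE wS).
  by move=> /orP[/eqP->|kW]; [rewrite (negbTE wS)|apply: h].
apply: eq_bigl => S; rewrite andbC [RHS]andbC.
have [wS /=|//] := boolP (w \in S).
apply/idP/andP => [ind|[/indepP h dis]].
  split; first by apply: indep_mono ind; apply: subsetUr.
  apply/pred0Pn => -[g /= /andP[gS]]; rewrite inE => /andP[gW rwg].
  move/indepP: ind => /(_ w g); rewrite setU11 in_setU1 gW orbT rwg.
  by move/(_ isT isT wS gS).
have nr g : g \in W -> g \in S -> ~~ r w g.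
  move=> gW gS; apply: contraL dis => rwg; apply/pred0Pn; exists g.
  by rewrite /= gS inE gW.
apply/indepP => g k; rewrite !in_setU1 => /orP[/eqP->|gW] /orP[/eqP->|kW] //.
- by move=> _; apply: nr.
- by move=> gS _; rewrite r_sym; apply: nr.
- exact: h.
Qed.

Lemma bernoulli_ge (q : R) d : 0 <= q <= 1 -> 1 - d%:R * q <= (1 - q) ^+ d.
Proof.
move=> q01; elim: d => [|d IH]; first by rewrite mul0r expr0 subr0.
have : 0 <= (d%:R : R) by rewrite ler0n.
have : (1 - q) ^+ d.+1 = (1 - q) ^+ d * (1 - q) by rewrite exprSr.
rewrite -natr1; move: IH q01; set u := _ ^+ d; set v := _ ^+ d.+1 => IH q01 vE d0.
by rewrite vE; nra.
Qed.

Lemma bernoulli_le (q : R) d : 0 <= q <= 1 ->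
  (1 - q) ^+ d <= 1 - d%:R * q + (d%:R * q) ^+ 2.
Proof.
move=> q01; elim: d => [|d IH]; first by rewrite mul0r expr0 subr0 expr0n addr0.
have d0 : 0 <= (d%:R : R) by rewrite ler0n.
rewrite exprSr -natr1.
apply: (@le_trans _ _ ((1 - d%:R * q + (d%:R * q) ^+ 2) * (1 - q))).
  by apply: ler_wpM2r => //; lra.
have : 0 <= d%:R ^+ 2 * q ^+ 3 by rewrite mulr_ge0 // exprn_ge0; lra.
have : 0 <= d%:R * q ^+ 2 by rewrite mulr_ge0 // exprn_ge0; lra.
have : 0 <= q ^+ 2 by rewrite exprn_ge0; lra.
by nra.
Qed.

Hypothesis p_small : p <= 24^-1.
Hypothesis deg8 : forall w, (#|[set h | r w h]%SET| <= 8)%N.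

Lemma nbrs_le8 W w : (#|nbrs W w| <= 8)%N.
Proof.
apply: leq_trans (deg8 w); apply/subset_leq_card/subsetP => h.
by rewrite !inE => /andP[].
Qed.

Lemma pr_indep_ge0 W : 0 <= Z W. Proof. exact: pr_ge0. Qed.

(** Adding [w] does harm only if [w] and one of its at most 8 neighbours are chosen. This lower
    bound serves the upper bound below: it shows that removing the neighbours of a vertex raises [Z]
    only slightly. *)
Lemma pr_indep_setU1_ge W w : w \notin W -> ~~ r w w ->
  (1 - 8 * p ^+ 2) * Z W <= Z (w |: W).
Proof.
move=> wW rww; rewrite pr_indep_setU1 //.
have ZD : Z W <= Z (W :\: nbrs W w) by apply/pr_indep_mono/subsetDl.
have b8 : 1 - 8 * p <= (1 - p) ^+ #|nbrs W w|.
  apply: le_trans (bernoulli_ge _ p01); rewrite lerD2l lerN2.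
  apply: ler_wpM2r; first by case/andP: p01.
  by rewrite ler_nat nbrs_le8.
have Z0 := pr_indep_ge0 W.
have : (1 - 8 * p) * Z W <= (1 - p) ^+ #|nbrs W w| * Z (W :\: nbrs W w).
  by apply: ler_pM => //; move: p01 p_small; lra.
move/(ler_wpM2l (proj1 (andP p01))).
set u := _ ^+ _ * _; nra.
Qed.

Lemma pr_indep_setD_ge W D : D \subset W -> {in W, forall w, ~~ r w w} ->
  (1 - 8 * p ^+ 2) ^+ #|D| * Z (W :\: D) <= Z W.
Proof.
move=> + Wr; have [m] := ubnP #|D|; elim: m D => // m IH D Dm DW.
have [->|[d dD]] := set_0Vmem D.
  by rewrite cards0 expr0 mul1r setD0.
have Dd : #|D| = #|D :\ d|.+1 by rewrite (cardsD1 d) dD.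
have dW : d \in W by apply: (subsetP DW).
have q0 : 0 <= 1 - 8 * p ^+ 2 by move: p01 p_small; nra.
apply: le_trans (IH (D :\ d) _ _); last 2 first.
- by move: Dm; rewrite Dd ltnS.
- by apply: subset_trans DW; apply: subD1set.
rewrite Dd exprSr -mulrA; apply: ler_wpM2l; first exact: exprn_ge0.
have -> : W :\: (D :\ d) = d |: (W :\: D).
  by apply/setP => g; rewrite !inE; case: eqP => // ->.
by apply: pr_indep_setU1_ge; [rewrite inE dD|apply: Wr].
Qed.

(** The exponent gained per edge: ideally [p ^+ 2], reduced by the second-order losses [16 * p] and
    [8 * p] of the next lemma. *)
Let kappa := (1 - 24 * p) * p ^+ 2.

(** The left side is the factor picked up by [Z] when a vertex with [d] neighbours is added. *)
Lemma elimination_factor d : (d <= 8)%N ->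
  (1 - p) + p * ((1 - p) / (1 - 8 * p ^+ 2)) ^+ d <= expR (- (kappa * d%:R)).
Proof.
move=> d8; apply: le_trans (expR_ge1Dx _).
have p0 : 0 <= p by case/andP: p01.
have p20 : 0 <= p ^+ 2 by rewrite exprn_ge0.
have q0 : 0 < 1 - 8 * p ^+ 2 by move: p01 p_small; nra.
(* [q] is chosen so that (1 - p) / (1 - 8 p^2) is at most 1 - q. *)
pose q := p * (1 - 16 * p).
have q01 : 0 <= q <= 1 by rewrite /q; apply/andP; split; move: p01 p_small; nra.
have m1 : (1 - p) / (1 - 8 * p ^+ 2) <= 1 - q.
  rewrite ler_pdivrMr // /q.
  have : 0 <= p ^+ 2 * (8 + 8 * p - 128 * p ^+ 2).
    by apply: mulr_ge0 => //; move: p01 p_small; nra.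
  nra.
have m0 : 0 <= (1 - p) / (1 - 8 * p ^+ 2).
  by apply: divr_ge0; [move: p01; lra|exact: ltW].
have md : ((1 - p) / (1 - 8 * p ^+ 2)) ^+ d <= 1 - d%:R * q + (d%:R * q) ^+ 2.
  apply: le_trans (bernoulli_le d q01); apply: lerXn2r; rewrite ?nnegrE //.
  by move: q01; lra.
have d0 : 0 <= (d%:R : R) by rewrite ler0n.
have d8R : (d%:R : R) <= 8 by rewrite ler_nat.
have qp : q <= p by rewrite /q; nra.
(* Since d q is at most 8 p, the quadratic term costs a factor 1 - 8 p; together with [q] this
   leaves (1 - 16 p)(1 - 8 p), which is at least 1 - 24 p. *)
have dq : d%:R * q * (1 - 8 * p) <= d%:R * q - (d%:R * q) ^+ 2.
  have dqp : d%:R * q <= 8 * p by apply: ler_pM => //; case/andP: q01.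
  have : 0 <= d%:R * q by rewrite mulr_ge0 //; case/andP: q01.
  nra.
have := ler_wpM2l p0 md.
have : d%:R * kappa <= p * (d%:R * q * (1 - 8 * p)).
  rewrite /kappa /q.
  have -> : p * (d%:R * (p * (1 - 16 * p)) * (1 - 8 * p)) =
     d%:R * ((1 - 24 * p) * p ^+ 2) + 128 * (d%:R * (p ^+ 2 * p ^+ 2)) by ring.
  rewrite lerDl.
  by do !apply: mulr_ge0 => //.
have := ler_wpM2l p0 dq.
set u := _ ^+ d; set v := (d%:R * q) ^+ 2; set k := kappa; nra.
Qed.

Lemma pr_indep_setU1_le W w : w \notin W -> {in w |: W, forall w, ~~ r w w} ->
  Z (w |: W) <= expR (- (kappa * #|nbrs W w|%:R)) * Z W.
Proof.
move=> wW Wr; rewrite pr_indep_setU1 //; last by apply: Wr; rewrite setU11.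
set d := #|_|; set Z' := Z (_ :\: _).
have q0 : 0 < (1 - 8 * p ^+ 2) ^+ d by apply: exprn_gt0; move: p01 p_small; nra.
have ZZ : Z' <= Z W / (1 - 8 * p ^+ 2) ^+ d.
  rewrite ler_pdivlMr // mulrC; apply: pr_indep_setD_ge.
    by apply/subsetP => g; rewrite inE => /andP[].
  by move=> g gW; apply: Wr; rewrite in_setU1 gW orbT.
apply: le_trans (ler_wpM2r (pr_indep_ge0 W) (elimination_factor (nbrs_le8 W w))).
rewrite [leRHS]mulrDl lerD2l -mulrA; apply: ler_wpM2l; first by case/andP: p01.
rewrite expr_div_n -/d mulrAC -mulrA.
by apply: ler_wpM2l => //; rewrite exprn_ge0 //; move: p01; lra.
Qed.

(** Building [W] up vertex by vertex pays for each edge once, when its second endpoint arrives; the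
    sum of degrees counts it twice, hence the division by 2. *)
Lemma pr_indep_loopless_le W : {in W, forall w, ~~ r w w} ->
  Z W <= expR (- (kappa * (\sum_(g in W) #|nbrs W g|)%:R / 2)).
Proof.
have [m] := ubnP #|W|; elim: m W => // m IH W Wm Wr.
have [->|[w wW]] := set_0Vmem W.
  rewrite big_set0 mulr0 mul0r oppr0 expR0 -(prT T p); exact: pr_mono.
pose V := W :\ w; have wV : w \notin V by rewrite setD11.
have WV : W = w |: V by rewrite setD1K.
have sumW : (\sum_(g in W) #|nbrs W g| =
    2 * #|nbrs V w| + \sum_(g in V) #|nbrs V g|)%N.
  have nW g : #|nbrs W g| = (r g w + #|nbrs V g|)%N.
    rewrite (cardsD1 w) inE wW; congr (_ + _)%N; apply: eq_card => h.
    by rewrite !inE andbA.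
  rewrite (big_setD1 w) //= nW (negbTE (Wr w wW)) add0n.
  rewrite (eq_bigr (fun g => r g w + #|nbrs V g|)%N) => [|g _]; last exact: nW.
  rewrite big_split /= addnA mul2n -addnn; congr (_ + _ + _)%N.
  rewrite -big_mkcondr /= sum1_card; apply: eq_card => h.
  by rewrite [LHS]inE /= !inE r_sym.
have -> : expR (- (kappa * (\sum_(g in W) #|nbrs W g|)%:R / 2)) =
    expR (- (kappa * #|nbrs V w|%:R)) *
    expR (- (kappa * (\sum_(g in V) #|nbrs V g|)%:R / 2)).
  by rewrite -expRD sumW natrD natrM; congr expR; field.
rewrite {1}WV; apply: le_trans (pr_indep_setU1_le wV _) _; first by rewrite -WV.
apply: ler_wpM2l; first exact: expR_ge0.
apply: IH => [|g]; first by move: Wm; rewrite (cardsD1 w) wW ltnS.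
by rewrite in_setD1 => /andP[_]; apply: Wr.
Qed.

Let L := [set g | r g g]%SET.

(** Discarding the looped vertices [L] loses at most 8 pairs for each element of [L] in the first
    coordinate, and as many for the second. *)
Lemma nonloop_pairs_le :
  (#|[set gh : T * T | (gh.1 != gh.2) && r gh.1 gh.2]%SET| <=
   \sum_(g in ~: L) #|nbrs (~: L) g| + 16 * #|L|)%N.
Proof.
rewrite -sum1_card.
rewrite (eq_bigl (fun gh : T * T => (gh.1 != gh.2) && r gh.1 gh.2)); last first.
  by move=> gh; rewrite inE.
rewrite -(pair_big_dep predT (fun g h => (g != h) && r g h) (fun _ _ => 1%N)) /=.
rewrite (bigID (fun g => g \in ~: L)) /=.
have -> : (16 * #|L| = 8 * #|L| + 8 * #|L|)%N by rewrite -mulnDl.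
rewrite addnA; apply: leq_add; last first.
  rewrite mulnC -sum_nat_const.
  rewrite [leqRHS](eq_bigl (fun g => g \notin ~: L)) => [|g]; last by rewrite !inE negbK.
  apply: leq_sum => g _; rewrite sum1_card; apply: leq_trans (deg8 g).
  by apply/subset_leq_card/subsetP => h; rewrite !inE [in X in X -> _]unfold_in => /andP[].
have -> : (8 * #|L| = \sum_(h in L) 8)%N by rewrite sum_nat_const mulnC.
apply: (@leq_trans (\sum_(g in ~: L) (#|nbrs (~: L) g| + \sum_(h in L) r g h))).
  apply: leq_sum => g _.
  rewrite -big_mkcondr /= (bigID (fun h => h \in L)) /= addnC; apply: leq_add.
    rewrite sum1_card; apply/subset_leq_card/subsetP => h.
    by rewrite !inE [in X in X -> _]unfold_in !inE => /andP[/andP[_ ->] ->].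
  rewrite !sum1_card; apply/subset_leq_card/subsetP => h.
  by rewrite !unfold_in => /andP[/andP[_ ->] ->].
rewrite big_split /= leq_add2l exchange_big /=; apply: leq_sum => h _.
rewrite -big_mkcondr /= sum1_card; apply: leq_trans (deg8 h).
apply/subset_leq_card/subsetP => g; rewrite [in X in X -> _]unfold_in !inE => /andP[_].
by rewrite r_sym.
Qed.

(** Looped vertices must be avoided, which gives the factor (1 - p)^|L| exactly; the remaining graph
    is loopless. *)
Lemma pr_indep_le e :
  (2 * e)%N = #|[set gh : T * T | (gh.1 != gh.2) && r gh.1 gh.2]%SET| ->
  pr p (indep setT) <= expR (- ((1 - 24 * p) * (p ^+ 2 * e%:R + p * #|L|%:R))).
Proof.
move=> eE.
have -> : pr p (indep setT) = (1 - p) ^+ #|L| * Z (~: L).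
  rewrite -setTD -pr_indep_disjoint ?subsetT //; apply: eq_pr => S.
  have [/indepP h|//] := boolP (indep setT S); rewrite /= .
  apply/esym/pred0Pn => -[g /= /andP[gS]]; rewrite inE => rgg.
  by have := h g g (in_setT g) (in_setT g) gS gS; rewrite rgg.
have nL : {in ~: L, forall w, ~~ r w w} by move=> w; rewrite !inE.
have p0 : 0 <= p by case/andP: p01.
have pL : (1 - p) ^+ #|L| <= expR (- (p * #|L|%:R)).
  rewrite -mulNr mulrC expRM_natl; apply: lerXn2r; rewrite ?nnegrE ?expR_ge0 //.
    by move: p01; lra.
  exact: expR_ge1Dx.
apply: le_trans (ler_pM _ _ pL (pr_indep_loopless_le nL)) _.
- by rewrite exprn_ge0 //; move: p01; lra.
- exact: pr_indep_ge0.
rewrite -expRD ler_expR.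
have := nonloop_pairs_le; rewrite -eE -(ler_nat R) natrD !natrM.
set E2 := (\sum_(_ in _) _)%:R; set l := #|L|%:R => hE.
have l0 : 0 <= l by rewrite ler0n.
have k0 : 0 <= kappa by rewrite /kappa mulr_ge0 ?exprn_ge0 //; move: p_small; lra.
have hE' : kappa * (e%:R - 8 * l) <= kappa * (E2 / 2) by apply: ler_wpM2l => //; lra.
(* This slack shows that the at most [8 * l] edges lost with the loops, worth [8 * kappa * l], are
   covered by the [24 * p ^+ 2 * l] given up in the loop term. *)
have : 0 <= p * l * (16 * p + 192 * p ^+ 2).
  by do !apply: mulr_ge0 => //; rewrite addr_ge0 ?mulr_ge0 ?exprn_ge0.
rewrite /kappa in hE' *; nra.
Qed.

End IndependentSets.

(** * Edge counts, and degrees in the dependency graphs *)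

Section Degrees.
Variable gT : finGroupType.
Implicit Types (r : rel gT) (x y g h : gT).

(** Each unordered edge is the image of exactly two ordered pairs. *)
Lemma double_nedges r : symmetric r -> (2 * nedges r)%N =
  #|[set gh : gT * gT | (gh.1 != gh.2) && r gh.1 gh.2]%SET|.
Proof.
move=> r_sym; set P := [set gh : gT * gT | _]%SET.
pose f (gh : gT * gT) : {set gT} := [set gh.1; gh.2]%SET.
have -> : nedges r = #|f @: P|.
  apply: eq_card => E; rewrite inE; apply/existsP/imsetP.
    move=> [g /existsP[h /and3P[gh rgh /eqP->]]].
    by exists (g, h); rewrite // inE gh.
  move=> [[g h]]; rewrite inE /= => /andP[gh rgh ->].
  by exists g; apply/existsP; exists h; rewrite gh rgh eqxx.
rewrite -[RHS]sum1_card (partition_big_imset f) /= mulnC -sum_nat_const.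
apply: eq_bigr => E /imsetP[[g h] ghP ->]; move: ghP; rewrite inE /= => /andP[gh rgh].
rewrite sum1_card -[LHS](_ : #|[set (g, h); (h, g)]%SET| = 2)%N; last first.
  by rewrite cards2 xpair_eqE negb_and gh.
apply: eq_card => -[a b]; rewrite !inE unfold_in /= !inE /= !xpair_eqE.
apply/orP/andP => [[/andP[/eqP-> /eqP->]|/andP[/eqP-> /eqP->]]|].
- by rewrite gh rgh eqxx.
- by rewrite eq_sym gh r_sym rgh /f /= setUC eqxx.
rewrite /f /= => -[/andP[ab rab] /eqP abgh].
have : a \in [set g; h]%SET by rewrite -abgh set21.
have : b \in [set g; h]%SET by rewrite -abgh set22.
rewrite !inE => /orP[]/eqP bE /orP[]/eqP aE; move: ab; rewrite ?aE ?bE ?eqxx //;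
  by [right|left].
Qed.

Definition degree r g := #|[set h | r g h]%SET|.

(** The handshake identity; a loop adds only 1 to the degree of its vertex. *)
Lemma sum_degree r : symmetric r ->
  (\sum_g degree r g = 2 * nedges r + nloops r)%N.
Proof.
move=> r_sym; rewrite double_nedges // -sum1_card.
rewrite (eq_bigl (fun gh : gT * gT => (gh.1 != gh.2) && r gh.1 gh.2)); last first.
  by move=> gh; rewrite inE.
rewrite -(pair_big_dep predT (fun g h => (g != h) && r g h) (fun _ _ => 1%N)) /=.
rewrite /nloops -[X in (_ + X)%N]sum1_card.
rewrite [X in (_ + X)%N](eq_bigl (fun g => r g g)) => [|g]; last by rewrite inE.
rewrite [X in (_ + X)%N]big_mkcond -big_split /=; apply: eq_bigr => g _.
rewrite /degree (cardsD1 g) inE addnC sum1_card; congr (_ + _)%N.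
  by apply: eq_card => h; rewrite [RHS]unfold_in !inE eq_sym.
Qed.


Lemma expg2E g : (g ^+ 2 = g * g)%g. Proof. by []. Qed.

(** Solved for [x]: adjacency means that [x] is a product, in either order, of one of g, g^-1 and
    one of h, h^-1. This makes the symmetry visible. *)
Lemma dep_graphE x g h : dep_graph x g h =
  [|| x == h * g^-1, x == h * g, x == g * h^-1, x == g^-1 * h^-1,
      x == g^-1 * h, x == h^-1 * g, x == g * h | x == h^-1 * g^-1]%g.
Proof.
pose simp := (invMg, invgK, mulgK, mulKg, mulgKV, mulKVg).
rewrite /dep_graph !inE; apply/idP/idP.
  do 7! [case/orP=> [/eqP->|]; first by rewrite ?simp eqxx ?orbT].
  by move/eqP->; rewrite ?simp eqxx ?orbT.
do 7! [case/orP=> [/eqP->|]; first by rewrite ?simp eqxx ?orbT].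
  by move/eqP->; rewrite ?simp eqxx ?orbT.
Qed.

Lemma dep_graph_sym x : symmetric (dep_graph x).
Proof.
suff sub g h : dep_graph x g h -> dep_graph x h g.
  by move=> g h; apply/idP/idP; apply: sub.
rewrite !dep_graphE; do 7! [case/orP=> [->|]; first by rewrite ?orbT].
by move=> ->; rewrite ?orbT.
Qed.

Lemma degree_le r g (s : seq gT) : (forall h, r g h -> h \in s) ->
  (degree r g <= size s)%N.
Proof.
move=> rs; apply: leq_trans (card_size s); apply/subset_leq_card/subsetP => h.
by rewrite inE; apply: rs.
Qed.

Lemma degree_ge r g (s : seq gT) : uniq s -> {in s, forall h, r g h} ->
  (size s <= degree r g)%N.
Proof.
move=> /card_uniqP <- rs; apply/subset_leq_card/subsetP => h /rs.
by rewrite inE.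
Qed.

Lemma dep_degree_le8 x g : (degree (dep_graph x) g <= 8)%N.
Proof. by apply: (@degree_le _ _ [:: _; _; _; _; _; _; _; _]) => h; apply. Qed.

Lemma dep_degree_invol x g : (x ^+ 2 = 1)%g -> (degree (dep_graph x) g <= 4)%N.
Proof.
move=> x2; have xV : (x^-1 = x)%g by apply/eqP; rewrite eq_invg_mul -x2.
apply: (@degree_le _ _ [:: x * g; x * g^-1; g * x; g^-1 * x]%g) => h.
rewrite /dep_graph xV !inE.
do 7! [case/orP=> [->|]; first by rewrite ?orbT].
by move=> ->; rewrite ?orbT.
Qed.

(* Both [x] and [g] commute with [x^2 = g^2], so inverting either one only
   multiplies a product of the two by this common square. *)
Lemma dep_degree_same_square x g : (g ^+ 2 = x ^+ 2)%g -> (x ^+ 4 = 1)%g ->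
  (degree (dep_graph x) g <= 4)%N.
Proof.
move=> gx x4; have [z zE] : exists z, z = (x ^+ 2)%g by exists (x ^+ 2)%g.
have z2 : (z * z = 1)%g by rewrite zE -expgD.
have xV : (x^-1 = z * x)%g by apply/eqP; rewrite eq_invg_mul zE -!expgSr -expgS x4.
have gV : (g^-1 = z * g)%g.
  by apply/eqP; rewrite eq_invg_mul zE -gx -expgSr -expgS (expgM g 2 2) gx -expgM x4.
have cx : (x * z = z * x)%g by rewrite zE -expgS -expgSr.
have cg : (g * z = z * g)%g by rewrite zE -gx -expgS -expgSr.
apply: (@degree_le _ _ [:: x * g; z * (x * g); g * x; z * (g * x)]%g) => h.
rewrite /dep_graph xV gV !inE.
have e1 : (x * (z * g) = z * (x * g))%g by rewrite !mulgA cx.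
have e2 : (g * (z * x) = z * (g * x))%g by rewrite !mulgA cg.
rewrite -!mulgA e1 e2 !mulgA z2 !mul1g -!mulgA.
do 7! [case/orP=> [->|]; first by rewrite ?orbT].
by move=> ->; rewrite ?orbT.
Qed.

Lemma dep_degree_ge2 x g : (x ^+ 2 != 1)%g -> (2 <= degree (dep_graph x) g)%N.
Proof.
move=> x2; apply: (@degree_ge _ _ [:: x * g; x^-1 * g]%g).
  rewrite /= andbT inE; apply: contraNneq x2 => /mulIg xV.
  by rewrite expg2E {2}xV mulgV.
by move=> h; rewrite !inE /dep_graph !inE => /orP[]->; rewrite ?orbT.
Qed.

(** If xg, x^-1 g, gx, gx^-1 are distinct, they are four neighbours. Otherwise [g] commutes with [x]
    or conjugates it to its inverse, and then xg, x^-1 g, xg^-1, x^-1 g^-1 are distinct outside the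
    excluded cases. *)
Lemma dep_degree_ge4 x g :
  (x ^+ 2 != 1)%g -> (g ^+ 2 != 1)%g -> ((g * x) ^+ 2 != 1)%g ->
  ((g * x^-1) ^+ 2 != 1)%g -> ~~ ((x ^+ 4 == 1) && (g ^+ 2 == x ^+ 2))%g ->
  (4 <= degree (dep_graph x) g)%N.
Proof.
move=> x2 g2 gx2 gxV2 gx.
have xVx : (x != x^-1)%g by apply: contraNneq x2 => e; rewrite expg2E {2}e mulgV.
have gVg : (g != g^-1)%g by apply: contraNneq g2 => e; rewrite expg2E {2}e mulgV.
have [comm|ncomm] := boolP ((g * x == x * g) || (g * x == x^-1 * g))%g; last first.
  move: ncomm; rewrite negb_or => /andP[n1 n2].
  apply: (@degree_ge _ _ [:: x * g; x^-1 * g; g * x; g * x^-1]%g).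
    rewrite /= !inE !negb_or !andbT (inj_eq (mulIg g)) (inj_eq (mulgI g)) xVx.
    rewrite (eq_sym (x * g)%g) (eq_sym (x^-1 * g)%g) n1 n2 /= ?andbT; apply/andP; split.
      apply: contraNneq n2 => e; apply/eqP.
      by rewrite -[g in LHS](mulKg x) e -mulgA mulgKV.
    apply: contraNneq n1 => e; apply/eqP.
    by rewrite -[g in LHS](mulKVg x) e -mulgA mulgKV.
  by move=> h; rewrite !inE /dep_graph !inE => /or4P[]->; rewrite ?orbT.
apply: (@degree_ge _ _ [:: x * g; x^-1 * g; x * g^-1; x^-1 * g^-1]%g); last first.
  by move=> h; rewrite !inE /dep_graph !inE => /or4P[]->; rewrite ?orbT.
rewrite /= !inE !negb_or !andbT !(inj_eq (mulIg _)) !(inj_eq (mulgI _)) xVx gVg /= ?andbT.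
(* Conjugation by [g] inverts x^2, yet [g] commutes with g^2, which is x^2 or its inverse. So x^2
   equals its inverse, x^4 = 1 and g^2 = x^2, which was excluded. *)
have inverted : (g * x = x^-1 * g)%g -> (g ^+ 2 = x ^+ 2 \/ g ^+ 2 = x^-1 ^+ 2)%g -> False.
  move=> c g2E; case/negP: gx.
  have cx : (g * x ^+ 2 = x^-1 ^+ 2 * g)%g by rewrite !expg2E mulgA c -mulgA c mulgA.
  have xx : (x ^+ 2 = x^-1 ^+ 2)%g.
    apply: (mulgI g); rewrite cx; case: g2E => g2E.
      have : (g * x ^+ 2 = x ^+ 2 * g)%g by rewrite -g2E -expgS -expgSr.
      by rewrite cx => /mulIg ->; rewrite -g2E -expgS -expgSr.
    by rewrite -g2E -expgS -expgSr.
  have -> : (g ^+ 2 = x ^+ 2)%g by case: g2E => ->.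
  by rewrite eqxx andbT (expgD x 2 2) {2}xx -expgMn ?mulgV ?expg1n //; apply: commuteV.
apply/andP; split; apply/eqP => e; case/orP: comm => /eqP c.
- by case/eqP: gx2; rewrite expg2E {2}c e mulgA mulgK mulgV.
- apply: inverted => //; right.
  by rewrite !expg2E -{1}[g](mulKg x) e !mulgA mulgKV.
- have cV : (g * x^-1 = x^-1 * g)%g by rewrite -{1}[g](mulKg x) -c mulgA mulgK.
  by case/eqP: gxV2; rewrite expg2E {2}cV e mulgA mulgKV mulgV.
- apply: inverted => //; left.
  by rewrite !expg2E -{1}[g](mulKVg x) e !mulgA mulgKV.
Qed.

Lemma dep_loop x g : x != 1%g -> dep_graph x g g ->
  (g ^+ 2 == x)%g || (g ^+ 2 == x^-1)%g.
Proof.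
move=> x1; rewrite dep_graphE mulgV mulVg (negbTE x1) /= expg2E.
have gV : (x == g^-1 * g^-1)%g = (g * g == x^-1)%g.
  by rewrite -invMg eq_sym eq_invg_sym eq_sym.
by rewrite gV !(eq_sym x); do !case: eqP.
Qed.

(** Double counting: a given [g] can carry a loop only for x = g^2 and x = g^-2. *)
Lemma sum_dep_loops : (\sum_(x : gT | x != 1%g) nloops (dep_graph x) <= 2 * #|gT|)%N.
Proof.
apply: (@leq_trans (\sum_x \sum_g ((g ^+ 2 == x)%g + (g ^+ 2 == x^-1)%g))).
  rewrite big_mkcond /=; apply: leq_sum => x _; case: ifP => // x1.
  rewrite /nloops -sum1_card big_mkcond /=; apply: leq_sum => g _.
  by rewrite inE; case: ifP => // /(dep_loop x1) /orP[]->; rewrite ?addn1.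
rewrite exchange_big /= mulnC -sum_nat_const; apply: leq_sum => g _.
have card1 (y : gT) : (\sum_(x : gT) (y == x) = 1)%N.
  rewrite (bigD1 y) //= eqxx big1 // => x xy.
  by rewrite eq_sym (negbTE xy).
rewrite big_split /= card1 (reindex_inj invg_inj) /=.
by under eq_bigr do rewrite invgK; rewrite card1.
Qed.

Lemma nedges_ge x : (x ^+ 2 != 1)%g ->
  (2 * #|gT| <= 2 * nedges (dep_graph x) + nloops (dep_graph x))%N.
Proof.
move=> x2; rewrite -sum_degree; last exact: dep_graph_sym.
by rewrite mulnC -sum_nat_const; apply: leq_sum => g _; apply: dep_degree_ge2.
Qed.

Definition sqroots y := [set g : gT | (g ^+ 2 == y)%g]%SET.

(** All degrees are at least 2, so each exceptional vertex costs at most 2 against degree 4. Three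
    of the exceptional sets are translates of the solutions of g^2 = 1. *)
Lemma nedges_ge_sqroots x : (x ^+ 2 != 1)%g ->
  (4 * #|gT| <= 2 * nedges (dep_graph x) + nloops (dep_graph x) +
     2 * (3 * #|sqroots 1%g| + (x ^+ 4 == 1)%g * #|sqroots (x ^+ 2)%g|))%N.
Proof.
move=> x2; rewrite -sum_degree; last exact: dep_graph_sym.
apply: (@leq_trans (\sum_g (degree (dep_graph x) g + 2 * (((g ^+ 2 == 1)%g +
   ((g * x) ^+ 2 == 1)%g + ((g * x^-1) ^+ 2 == 1)%g) + (x ^+ 4 == 1)%g * (g ^+ 2 == x ^+ 2)%g)))).
  rewrite mulnC -sum_nat_const; apply: leq_sum => g _.
  have := dep_degree_ge2 g x2; have := @dep_degree_ge4 x g x2.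
  by do 5 ?[case: (_ == _) => /=]; lia.
have card1 (y z : gT) : (\sum_g ((g * z) ^+ 2 == y)%g = #|sqroots y|)%N.
  rewrite -[RHS]sum1_card [RHS]big_mkcond /= [RHS](reindex_inj (mulIg z)) /=.
  by apply: eq_bigr => g _; rewrite inE; case: eqP.
have := card1 1%g 1%g; have := card1 (x ^+ 2)%g 1%g.
under eq_bigr do rewrite mulg1; move=> c1.
under eq_bigr do rewrite mulg1; move=> c2.
rewrite big_split /= leq_add2l -big_distrr /= !big_split /= -big_distrr /= !card1 c1 c2.
by rewrite leq_mul2l leq_add2r !mulSn mul0n addn0 addnA leqnn orbT.
Qed.

Lemma nedges_le x : (2 * nedges (dep_graph x) <= 8 * #|gT|)%N.
Proof.
apply: (@leq_trans (2 * nedges (dep_graph x) + nloops (dep_graph x))%N).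
  exact: leq_addr.
rewrite -sum_degree; last exact: dep_graph_sym.
by rewrite mulnC -sum_nat_const; apply: leq_sum => g _; apply: dep_degree_le8.
Qed.

Lemma nedges_invol_le x : (x ^+ 2 = 1)%g ->
  (2 * nedges (dep_graph x) <= 4 * #|gT|)%N.
Proof.
move=> x2; apply: (@leq_trans (2 * nedges (dep_graph x) + nloops (dep_graph x))%N).
  exact: leq_addr.
rewrite -sum_degree; last exact: dep_graph_sym.
by rewrite mulnC -sum_nat_const; apply: leq_sum => g _; apply: dep_degree_invol.
Qed.

Lemma nedges_sqroots_le x : (x ^+ 4 = 1)%g ->
  (2 * nedges (dep_graph x) + 4 * #|sqroots (x ^+ 2)%g| <= 8 * #|gT|)%N.
Proof.
move=> x4; apply: (@leq_trans (2 * nedges (dep_graph x) + nloops (dep_graph x)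
    + 4 * #|sqroots (x ^+ 2)%g|)%N).
  by rewrite leq_add2r leq_addr.
rewrite -sum_degree; last exact: dep_graph_sym.
have -> : #|sqroots (x ^+ 2)%g| = (\sum_g (g ^+ 2 == x ^+ 2)%g)%N.
  rewrite -sum1_card big_mkcond /=.
  by apply: eq_bigr => g _; rewrite inE; case: eqP.
rewrite big_distrr -big_split /= mulnC -sum_nat_const; apply: leq_sum => g _.
case: eqP => [gx|_]; first by have := dep_degree_same_square gx x4; lia.
by rewrite muln0 addn0 dep_degree_le8.
Qed.

End Degrees.

(** * From diameter greater than 2 to independent sets, and the union bound *)

Section Diameter.
Variables (R : realType) (gT : finGroupType).
Implicit Types (S : {set gT}) (x : gT).

Lemma cayley_step S (u a : gT) : a != 1%g -> (a \in S) || (a^-1 \in S)%g ->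
  cayley_graph S u (a * u)%g.
Proof.
move=> a1 aS; rewrite /cayley_graph mulgK invMg mulgA mulgV mul1g aS andbT.
by apply: contra_neq a1 => uau; apply: (mulIg u); rewrite mul1g -uau.
Qed.

Lemma not_indep_prod S x : ~~ indep (dep_graph x) setT S ->
  exists a b, [/\ x = (a * b)%g, (a \in S) || (a^-1 \in S)%g
    & (b \in S) || (b^-1 \in S)%g].
Proof.
move=> nind.
have [g [h [gS hS]]] : exists g h, [/\ g \in S, h \in S & dep_graph x g h].
  apply: contrapT => nex; case/negP: nind; apply/indepP => g h _ _ gS hS.
  by apply/negP => xgh; apply: nex; exists g, h.
rewrite dep_graphE.
do 7! [case/orP=> [/eqP->|];
  first by do 2 eexists; split; [reflexivity| |]; rewrite ?invgK ?gS ?hS ?orbT].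
by move/eqP->; do 2 eexists; split; [reflexivity| |]; rewrite ?invgK ?gS ?hS ?orbT.
Qed.

(** For distinct [u] and [v], dependence for x = v u^-1 gives x = ab with [a] and [b] in [S] up to
    inversion, hence the walk u, bu, abu = v. If [a] or [b] is 1 this stalls once, and a single step
    suffices. *)
Lemma diameter_le2 S :
  (forall x, x != 1%g -> ~~ indep (dep_graph x) setT S) ->
  (diameter R (cayley_graph S) <= 2%:E)%E.
Proof.
move=> nind; apply: ge_ereal_sup => _ [[u v] _ <-] /=.
suff [q qS q2] : exists2 q, path (cayley_graph S) u q /\ last u q = v & (size q <= 2)%N.
  apply: (@le_trans _ _ ((size q)%:R)%:E); last by rewrite lee_fin ler_nat.
  by apply: ereal_inf_lbound; exists q.
have [->|uv] := eqVneq u v; first by exists [::].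
have x1 : (v * u^-1 != 1)%g by rewrite -eq_mulgV1 eq_sym.
have [a [b [xE aS bS]]] := not_indep_prod (nind _ x1).
have vE : v = (a * b * u)%g by rewrite -xE mulgKV.
have [b1|b1] := eqVneq b 1%g.
  exists [:: v] => //; split => //=; rewrite andbT vE b1 mulg1.
  by apply: cayley_step => //; move: x1; rewrite xE b1 mulg1.
have [a1|a1] := eqVneq a 1%g.
  by exists [:: v] => //; split => //=; rewrite andbT vE a1 mul1g; apply: cayley_step.
exists [:: b * u; v]%g => //; split => //=.
by rewrite andbT vE -mulgA !cayley_step.
Qed.

Variable p : R.
Hypothesis p01 : 0 <= p <= 1.

Lemma cayley_prob_le1 (Q : rel gT -> Prop) : cayley_prob p Q <= 1.
Proof.
rewrite -(prT gT p).
exact: (@pr_mono R gT p p01 (fun S => `[< Q (cayley_graph S) >]) predT).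
Qed.

Lemma cayley_prob_diameter_ge :
  1 - \sum_(x : gT | x != 1%g) pr p (indep (dep_graph x) setT) <=
  cayley_prob p (fun r : rel gT => (diameter R r <= 2%:E)%E).
Proof.
have := pr_union p01 (fun x : gT => x != 1%g) (fun x => indep (dep_graph x) setT).
rewrite -(opprK (pr p _)) lerNl.
rewrite -(lerD2l 1) => /le_trans; apply.
rewrite -pr_predC; apply: (@pr_mono R gT p p01 _ (fun S => `[< _ >])) => S /=.
move=> /existsPn nex; apply/asboolP/diameter_le2 => x x1.
by have := nex x; rewrite x1.
Qed.

Lemma pr_indep_dep_le x : p <= 24^-1 ->
  pr p (indep (dep_graph x) setT) <=
  expR (- ((1 - 24 * p) * (p ^+ 2 * (nedges (dep_graph x))%:R
                            + p * (nloops (dep_graph x))%:R))).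
Proof.
move=> p24; apply: pr_indep_le => //.
- exact: dep_graph_sym.
- exact: dep_degree_le8.
- exact/double_nedges/dep_graph_sym.
Qed.

End Diameter.

(** * Comparison of the independence probabilities with the sum of [dep_f] *)

Section Exponents.
Variables (R : realType) (gT : finGroupType).
Implicit Types (x y : gT).

Local Notation n := (#|gT|%:R : R).
Local Notation l := (ln n).
Local Notation s := (Num.sqrt (l / n)).
Local Notation e x := ((nedges (dep_graph x))%:R : R).
Local Notation ell x := ((nloops (dep_graph x))%:R : R).

Lemma natr_card_ge1 : 1 <= n.
Proof. by rewrite (ler_nat _ 1); apply/card_gt0P; exists 1%g. Qed.

Lemma natr_card_gt0 : 0 < n. Proof. exact: lt_le_trans natr_card_ge1. Qed.

Lemma ln_card_ge0 : 0 <= l. Proof. by rewrite ln_ge0 // natr_card_ge1. Qed.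

Lemma dep_fE x (c : R) : dep_f x c =
  expR (- (c * (e x / n) * l)
        - Num.sqrt c * ((if (x ^+ 2 == 1)%g then 1 else 2) * s * ell x)).
Proof.
rewrite /dep_f /dep_g /dep_h /powR (gt_eqF natr_card_gt0) (gt_eqF (expR_gt0 _)) expRK.
rewrite expRD; congr (_ * _); first by congr expR; ring.
by case: (x ^+ 2 == 1)%g; rewrite (gt_eqF (expR_gt0 _)) expRK; congr expR; ring.
Qed.

Lemma dep_f_ge0 x (c : R) : 0 <= dep_f x c.
Proof. by rewrite dep_fE expR_ge0. Qed.

(** This is [dep_f x b] with every loop counted once, also when x^2 is not 1: what the probability
    estimate actually delivers. *)
Definition independence_bound (b : R) x :=
  expR (- (b * (e x / n) * l) - Num.sqrt b * (s * ell x)).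

Lemma sqrt_ln_div_card : s * Num.sqrt n = Num.sqrt l.
Proof.
rewrite -sqrtrM ?divr_ge0 ?ln_card_ge0 ?(ltW natr_card_gt0) //.
by rewrite divfK // gt_eqF // natr_card_gt0.
Qed.

Lemma sqr_sqrt_card : Num.sqrt n * Num.sqrt n = n.
Proof. by rewrite -expr2 sqr_sqrtr // ltW // natr_card_gt0. Qed.

Lemma sqr_sqrt_ln_card : Num.sqrt l * Num.sqrt l = l.
Proof. by rewrite -expr2 sqr_sqrtr // ln_card_ge0. Qed.

Lemma sqrt_card_ge1 : 1 <= Num.sqrt n.
Proof. by rewrite -[leLHS]sqrtr1; apply: ler_wsqrtr; exact: natr_card_ge1. Qed.

(** Markov's inequality applied to the total of at most 2n loops. *)
Lemma card_many_loops :
  #|[set x : gT | (x != 1%g) && (Num.sqrt n < ell x)]%SET|%:R <= 2 * Num.sqrt n.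
Proof.
set Y := [set x | _]%SET.
have sn0 : 0 < Num.sqrt n by apply: lt_le_trans sqrt_card_ge1.
rewrite -(ler_pM2r sn0) -mulrA sqr_sqrt_card -natrM.
apply: (@le_trans _ _ (\sum_(x in Y) ell x)); last first.
  rewrite -natr_sum ler_nat; apply: leq_trans (sum_dep_loops gT).
  rewrite [leqRHS](bigID (fun x => x \in Y)) /=; apply: leq_trans (leq_addr _ _).
  rewrite (eq_bigl (fun x => (x != 1%g) && (x \in Y))) // => x.
  by rewrite inE; case: (x != 1%g).
rewrite -sumr_const mulr_suml; apply: ler_sum => x.
by rewrite inE => /andP[_ /ltW]; rewrite mul1r.
Qed.

(** At least half of tau n elements of [Y] have at most sqrt n loops, and each of these contributes
    at least n^(-aA) up to a factor exp(-O(sqrt(log n))). As the whole sum is at most 1, the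
    exponent a A cannot be much below 1. *)
Lemma dense_exponent_ge (a A tau tau1 : R) (Y : {set gT}) :
  0 < a -> 0 < tau -> dep_f_sum gT a <= 1 ->
  4 * Num.sqrt n <= tau * n ->
  2 * Num.sqrt a * Num.sqrt l + ln (2 / tau) <= tau1 * l ->
  0 < l ->
  1%g \notin Y -> tau * n <= #|Y|%:R ->
  {in Y, forall y, e y <= A * n} ->
  1 - tau1 <= a * A.
Proof.
move=> a0 tau0 f1 n_large l_large l0 Y1 Yn YA.
pose L := [set x : gT | (x != 1%g) && (Num.sqrt n < ell x)]%SET.
have YL : tau / 2 * n <= #|Y :\: L|%:R.
  have : #|Y|%:R <= #|Y :\: L|%:R + #|L|%:R :> R.
    rewrite -natrD ler_nat -(cardsID L Y) addnC leq_add2l.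
    by apply/subset_leq_card/subsetIr.
  by have := card_many_loops; rewrite -/L; lra.
pose v := expR (- (a * A * l) - 2 * Num.sqrt a * Num.sqrt l).
have f_ge y : y \in Y :\: L -> v <= dep_f y a.
  rewrite inE => /andP[yL yY]; rewrite dep_fE ler_expR.
  have y1 : y != 1%g by apply: contraNneq Y1 => <-.
  have {yL} ly : ell y <= Num.sqrt n by move: yL; rewrite inE y1 -leNgt.
  have ey : a * (e y / n) * l <= a * A * l.
    apply: ler_wpM2r; first exact: ln_card_ge0.
    by apply: ler_wpM2l; [exact: ltW|rewrite ler_pdivrMr ?natr_card_gt0 ?YA].
  have sl : s * ell y <= Num.sqrt l.
    by rewrite -sqrt_ln_div_card; apply: ler_wpM2l => //; exact: sqrtr_ge0.
  have sl0 : 0 <= s * ell y by rewrite mulr_ge0 // sqrtr_ge0.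
  have k2 : (if (y ^+ 2 == 1)%g then 1 else 2) * s * ell y <= 2 * Num.sqrt l.
    by rewrite -mulrA; case: ifP => _; lra.
  have := ler_wpM2l (sqrtr_ge0 a) k2.
  set u := _ * (_ * s * _); lra.
have : tau / 2 * n * v <= 1.
  apply: le_trans f1; apply: (@le_trans _ _ (\sum_(y in Y :\: L) v)).
    rewrite sumr_const -[leRHS]mulr_natl; apply: ler_wpM2r => //; exact: expR_ge0.
  apply: (@le_trans _ _ (\sum_(y in Y :\: L) dep_f y a)); first exact: ler_sum.
  rewrite /dep_f_sum [leRHS](bigID (fun y => y \in Y :\: L)) /=.
  rewrite (eq_bigl (fun y => (y != 1%g) && (y \in Y :\: L))); last first.
    move=> y; rewrite andbC; have [yY|//] := boolP (y \in Y :\: L).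
    by rewrite /=; apply/esym; apply: contraNneq Y1 => <-; move: yY; rewrite inE => /andP[].
  by rewrite lerDl; apply: sumr_ge0 => y _; apply: dep_f_ge0.
have -> : tau / 2 * n = expR (l - ln (2 / tau)).
  rewrite expRD expRN !lnK ?posrE ?natr_card_gt0 ?divr_gt0 //.
  by rewrite invf_div mulrC.
rewrite -expRD -[leRHS]expR0 ler_expR => ex.
rewrite -(ler_pM2r l0); nra.
Qed.

(** * Lower bound on the edge exponent when x^2 is not 1 *)

Section NonInvolution.
Variables (a tau tau1 : R).
Hypotheses (a0 : 0 < a) (tau01 : 0 < tau <= 1) (f1 : dep_f_sum gT a <= 1).
Hypothesis n_large : 8 * Num.sqrt n <= tau * n.
Hypothesis l_large : 2 * Num.sqrt a * Num.sqrt l + ln (4 / tau) <= tau1 * l.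
Hypothesis l0 : 0 < l.

(** Halving [tau] absorbs the [- 1], which allows the identity to be removed from [Y]. *)
Let dense (Y : {set gT}) A : 1%g \notin Y -> tau * n - 1 <= #|Y|%:R ->
  {in Y, forall y, e y <= A * n} -> 1 - tau1 <= a * A.
Proof.
move=> Y1 Yn; apply: (@dense_exponent_ge a A (tau / 2)) => //.
- by case/andP: tau01 => t0 _; lra.
- by move: n_large; lra.
- have -> // : 2 / (tau / 2) = 4 / tau.
  by case/andP: tau01 => t0 _; field; rewrite gt_eqF.
- by move: n_large sqrt_card_ge1 Yn; lra.
Qed.

Lemma nonloop_exponent_ge x : (x ^+ 2 != 1)%g -> ell x <= tau * n ->
  1 / 2 - tau1 / 2 - 5 * a * tau <= a * (e x / n).
Proof.
move=> x2 lx.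
have n0 := natr_card_gt0; case/andP: tau01 => t0 t1.
have at0 : 0 < a * tau by apply: mulr_gt0.
have tn0 : 0 < tau * n by apply: mulr_gt0.
(* Many solutions of g^2 = 1: their graphs have at most 2n edges, which bounds [a] from below, and
   minimum degree 2 suffices for [x]. *)
have [Jbig|Jsmall] := leP (tau * n) #|sqroots (1%g : gT)|%:R.
  have : 1 - tau1 <= a * 2.
    apply: (@dense (sqroots 1%g :\ 1%g)); first by rewrite setD11.
      apply: (le_trans (lerB Jbig (lexx 1))).
      rewrite (cardsD1 1%g (sqroots 1%g)) inE expg1n eqxx /= add1n -natr1.
      by rewrite addrK.
    move=> y; rewrite !inE => /andP[_ /eqP /nedges_invol_le].
    by rewrite -(ler_nat R) !natrM; lra.
  have := nedges_ge x2; rewrite -(ler_nat R) natrD !natrM => ex.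
  have : 1 - tau / 2 <= e x / n by rewrite ler_pdivlMr //; lra.
  by move/(ler_wpM2l (ltW a0)); lra.
have := nedges_ge_sqroots x2.
rewrite -(ler_nat R) !(natrD, natrM).
set J := #|_|%:R in Jsmall *; set z := #|sqroots (x ^+ 2)%g|%:R.
have [w wE] : exists w, w = ((x ^+ 4 == 1)%g)%:R * z by eexists.
rewrite -wE => ex.
(* Few exceptional vertices: e(x) is nearly 2n, while every element has at most 4n edges. *)
have small : w < tau * n ->
    1 / 2 - tau1 / 2 - 5 * a * tau <= a * (e x / n).
  move=> zs; have : 1 - tau1 <= a * 4.
    apply: (@dense [set~ 1%g]%SET); first by rewrite !inE eqxx.
      rewrite cardsC1 -subn1 natrB; last by apply/card_gt0P; exists 1%g.
      by rewrite lerD2r ler_piMl // ltW.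
    by move=> y _; have := nedges_le y; rewrite -(ler_nat R) !natrM; lra.
  have : 2 - 5 * tau <= e x / n by rewrite ler_pdivlMr //; lra.
  by move/(ler_wpM2l (ltW a0)); lra.
have [x4|x4] := eqVneq (x ^+ 4)%g 1%g; last first.
  by apply: small; rewrite wE (negbTE x4) mul0r mulr_gt0.
have [zbig|zsmall] := leP (tau * n) z; last by apply: small; rewrite wE x4 eqxx mul1r.
(* The square roots [y] of x^2 share their square with [x], so each of their graphs has the same [z]
   vertices of degree at most 4. The resulting 4 - 2 z/n is twice the main term 2 - z/n in the bound
   for [x]. *)
have : 1 - tau1 <= a * (4 - 2 * (z / n)).
  apply: (@dense (sqroots (x ^+ 2)%g)).
  - by rewrite inE expg1n eq_sym.
  - by rewrite -/z; lra.
  move=> y; rewrite inE => /eqP yx.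
  have y4 : (y ^+ 4 = 1)%g by rewrite (expgM y 2 2) yx -expgM.
  have := nedges_sqroots_le y4; rewrite yx -(ler_nat R) !(natrD, natrM) -/z.
  by rewrite mulrBl -(mulrA 2) divfK ?gt_eqF //; lra.
have : 2 - z / n - 4 * tau <= e x / n.
  rewrite ler_pdivlMr // !mulrBl divfK ?gt_eqF //.
  by move: ex; rewrite wE x4 eqxx mul1r; lra.
by move/(ler_wpM2l (ltW a0)); lra.
Qed.

End NonInvolution.

(** Involutions and elements with at most sqrt n loops are compared termwise with [dep_f x a]; the
    at most 2 sqrt n others contribute at most n^(-1/2 - d/4) each. The value of [tau] ensures 5 a
    tau <= d/8 and tau <= 1. *)
Lemma sum_independence_bound (a b : R) :
  let d := b - a in let tau := d / (40 * a + d) in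
  0 < a -> 0 < d -> dep_f_sum gT a <= 1 ->
  8 * Num.sqrt n <= tau * n ->
  2 * Num.sqrt a * Num.sqrt l + ln (4 / tau) <= d / 4 * l ->
  4 * Num.sqrt a <= d * Num.sqrt l -> 0 < l ->
  (1 / 2 + d / 4) * s <= Num.sqrt b * tau ->
  \sum_(x : gT | x != 1%g) independence_bound b x <=
  dep_f_sum gT a + 2 * expR (- (d / 4 * l)).
Proof.
move=> d tau a0 d0 f1 n_large l_large l_large2 l0 s_small.
have ad0 : 0 < 40 * a + d by lra.
have tau01 : 0 < tau <= 1.
  by rewrite divr_gt0 // ler_pdivrMr //; lra.
have atau : 5 * a * tau <= d / 8.
  by rewrite /tau mulrA ler_pdivrMr //; nra.
have ab : a < b by rewrite /d in d0; lra.
have sab : Num.sqrt a <= Num.sqrt b by rewrite ler_wsqrtr // ltW.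
have n0 := natr_card_gt0; have n0' := ltW n0; have l0' := ltW l0; have d0' := ltW d0.
have s0 : 0 <= s by exact: sqrtr_ge0.
have sl0 x : 0 <= s * ell x by rewrite mulr_ge0.
have en0 x : 0 <= e x / n * l by rewrite !mulr_ge0 ?invr_ge0.
pose L := [set x : gT | (x != 1%g) && (Num.sqrt n < ell x)]%SET.
have in_L x : x != 1%g -> (x ^+ 2 != 1)%g -> Num.sqrt n < ell x ->
    independence_bound b x <= expR (- ((1 / 2 + d / 4) * l)).
  move=> x1 x2 lx; rewrite ler_expR.
  have sb : 0 <= Num.sqrt b * (s * ell x) by rewrite mulr_ge0 ?sqrtr_ge0.
  have bx : 0 <= b * (e x / n) * l by rewrite -mulrA mulr_ge0 //; lra.
  (* With at least tau n loops, the loop term alone suffices. Otherwise a e/n is at least 1/2 - d/4,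
     and d e/n adds d/2. *)
  have [big|small] := leP (tau * n) (ell x).
    have lE : l = s * (s * n).
      by rewrite mulrA -expr2 sqr_sqrtr ?divfK ?gt_eqF // divr_ge0.
    have : (1 / 2 + d / 4) * l <= Num.sqrt b * (s * (tau * n)).
      have -> : (1 / 2 + d / 4) * l = (1 / 2 + d / 4) * s * (s * n).
        by rewrite {1}lE !mulrA.
      have -> : Num.sqrt b * (s * (tau * n)) = Num.sqrt b * tau * (s * n) by ring.
      by apply: ler_wpM2r => //; rewrite mulr_ge0.
    have : Num.sqrt b * (s * (tau * n)) <= Num.sqrt b * (s * ell x).
      by rewrite ler_wpM2l ?sqrtr_ge0 // ler_wpM2l.
    lra.
  have := nonloop_exponent_ge a0 tau01 f1 n_large l_large l0 x2 (ltW small).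
  have : 1 / 2 <= e x / n.
    have := nedges_ge x2; rewrite -(ler_nat R) natrD !natrM => ex.
    rewrite ler_pdivlMr //.
    have : tau * n <= n by rewrite ler_piMl //; case/andP: tau01.
    lra.
  move/(ler_wpM2l (ltW d0)) => h1 h2.
  have : (1 / 2 + d / 4) * l <= b * (e x / n) * l.
    apply: ler_wpM2r; first exact: ltW.
    rewrite /d in h1 h2 atau *; lra.
  lra.
have notin_L x : x != 1%g -> (x ^+ 2 == 1)%g || (ell x <= Num.sqrt n) ->
    independence_bound b x <= dep_f x a.
  move=> x1 xP; rewrite dep_fE ler_expR.
  have dE : b * (e x / n) * l = a * (e x / n) * l + d * (e x / n * l).
    by rewrite /d; ring.
  have sx : Num.sqrt a * (s * ell x) <= Num.sqrt b * (s * ell x) by rewrite ler_wpM2r.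
  have dx : 0 <= d * (e x / n * l) by rewrite mulr_ge0.
  have [x2|x2] := boolP (x ^+ 2 == 1)%g; first by rewrite mul1r; lra.
  have {xP} lx : ell x <= Num.sqrt n by move: xP; rewrite (negbTE x2).
  have ex : 1 / 2 <= e x / n.
    have := nedges_ge x2; rewrite -(ler_nat R) natrD !natrM => ex.
    rewrite ler_pdivlMr //.
    have : Num.sqrt n <= n by rewrite -[leRHS]sqr_sqrt_card ler_peMl ?sqrt_card_ge1 ?sqrtr_ge0.
    lra.
  have sl : s * ell x <= Num.sqrt l by rewrite -sqrt_ln_div_card; apply: ler_wpM2l.
  have h1 : Num.sqrt a * (s * ell x) <= Num.sqrt a * Num.sqrt l.
    by apply: ler_wpM2l => //; apply: sqrtr_ge0.
  (* The double count of loops in [dep_f] costs at most 2 sqrt(a l); the edge surplus d (e/n) l is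
     at least d l / 2. *)
  have h2 : 4 * Num.sqrt a * Num.sqrt l <= d * l.
    by rewrite -[in leRHS]sqr_sqrt_ln_card mulrA ler_wpM2r ?sqrtr_ge0.
  have h3 : d * l * (1 / 2) <= d * l * (e x / n).
    by apply: ler_wpM2l => //; rewrite mulr_ge0.
  have : 0 <= Num.sqrt b * (s * ell x) by rewrite mulr_ge0 ?sqrtr_ge0.
  rewrite -!mulrA in dE sx dx h1 h2 h3 *; lra.
rewrite (bigID (fun x => (x ^+ 2 == 1)%g || (ell x <= Num.sqrt n))) /=.
apply: lerD.
  apply: (@le_trans _ _ (\sum_(x : gT | (x != 1%g) &&
      ((x ^+ 2 == 1)%g || (ell x <= Num.sqrt n))) dep_f x a)).
    by apply: ler_sum => x /andP[]; apply: notin_L.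
  rewrite /dep_f_sum [leRHS](bigID (fun x => (x ^+ 2 == 1)%g || (ell x <= Num.sqrt n))) /=.
  by rewrite lerDl; apply: sumr_ge0 => x _; apply: dep_f_ge0.
apply: (@le_trans _ _ (\sum_(x in L) expR (- ((1 / 2 + d / 4) * l)))).
  rewrite [leRHS](bigID (fun x => (x ^+ 2 == 1)%g)) /=.
  apply: (@le_trans _ _ (\sum_(x in L | (x ^+ 2 != 1)%g) expR (- ((1 / 2 + d / 4) * l)))).
    rewrite [leRHS](eq_bigl (fun x => (x != 1%g) &&
        ~~ ((x ^+ 2 == 1)%g || (ell x <= Num.sqrt n)))); last first.
      by move=> x; rewrite inE negb_or -ltNge -andbA; congr (_ && _); rewrite andbC.
    apply: ler_sum => x /andP[x1]; rewrite negb_or -ltNge => /andP[].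
    exact: in_L.
  by rewrite lerDr; apply: sumr_ge0 => x _; apply: expR_ge0.
rewrite sumr_const -[leLHS]mulr_natl.
apply: (le_trans (ler_wpM2r (expR_ge0 _) card_many_loops)).
have -> : Num.sqrt n = expR (l / 2).
  have -> : l / 2 = ln (Num.sqrt n).
    rewrite -{1}sqr_sqrt_card lnM ?posrE ?(lt_le_trans _ sqrt_card_ge1) //; lra.
  by rewrite lnK // posrE (lt_le_trans _ sqrt_card_ge1).
rewrite -[leLHS]mulrA -expRD; apply: ler_wpM2l => //.
rewrite ler_expR; lra.
Qed.

(** The loss 1 - 24 p is absorbed by lowering [c] to [b]. The loop term needs this for square roots,
    and squaring gives more than enough for the edge term. *)
Lemma pr_le_independence_bound (b c : R) x :
  let p := Num.sqrt (c * l / n) in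
  0 < b -> 0 <= c ->
  Num.sqrt b <= (1 - 24 * p) * Num.sqrt c ->
  pr p (indep (dep_graph x) setT) <= independence_bound b x.
Proof.
move=> p b0 c0 bc.
have n0 := natr_card_gt0.
have pE : p = Num.sqrt c * s by rewrite /p -mulrA sqrtrM.
have p0 : 0 <= p by exact: sqrtr_ge0.
have sb0 : 0 < Num.sqrt b by rewrite sqrtr_gt0.
have sc0 := sqrtr_ge0 c.
have p24 : p <= 24^-1.
  (* Otherwise the right side of [bc] would be at most 0, against b > 0. *)
  have : 0 < 1 - 24 * p.
    by rewrite ltNge; apply/negP => h; have := mulr_le0_ge0 h sc0; lra.
  lra.
apply: (le_trans (@pr_indep_dep_le R gT p _ x p24)).
  by rewrite p0 /=; lra.
rewrite ler_expR.
have s0 : 0 <= s by exact: sqrtr_ge0.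
have h1 : Num.sqrt b * (s * ell x) <= (1 - 24 * p) * Num.sqrt c * (s * ell x).
  by apply: ler_wpM2r => //; rewrite mulr_ge0.
have bsq : b = Num.sqrt b * Num.sqrt b by rewrite -expr2 sqr_sqrtr // ltW.
have csq : c = Num.sqrt c * Num.sqrt c by rewrite -expr2 sqr_sqrtr.
have q1 : 0 <= 1 - 24 * p <= 1 by apply/andP; split; lra.
have bc2 : b <= (1 - 24 * p) * c.
  rewrite bsq [in leRHS]csq mulrA.
  by apply: ler_pM; rewrite ?(ltW sb0) //; apply: (le_trans bc); rewrite ler_piMl //; case/andP: q1.
have p2 : p ^+ 2 = c * (l / n).
  by rewrite /p sqr_sqrtr ?mulrA // -mulrA mulr_ge0 // divr_ge0 ?ln_card_ge0 // ltW.
have h2 : b * (e x / n * l) <= (1 - 24 * p) * c * (e x / n * l).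
  by apply: ler_wpM2r => //; rewrite !mulr_ge0 ?invr_ge0 ?ln_card_ge0 // ltW.
rewrite p2; move: h1 h2; rewrite [in X in _ -> _ -> X]pE.
nra.
Qed.

End Exponents.

(** * Asymptotics and the limit *)

(** The second bound holds because ln m = 2 ln(sqrt m) is at most 2 sqrt m, so (ln m)/m is of order
    at most 1/sqrt m. *)
Lemma sqrt_ln_large (R : realType) (M eta : R) : 0 < eta ->
  exists N : nat, forall m : nat, (N <= m)%N ->
    M <= Num.sqrt (ln (m%:R : R)) /\ Num.sqrt (ln (m%:R : R) / m%:R) <= eta.
Proof.
move=> eta0.
exists (maxn 1 (maxn (Num.truncn (expR (M ^+ 2))).+1
                     (Num.truncn ((4 / eta ^+ 2) ^+ 2)).+1)) => m.
rewrite !geq_max => /and3P[m1 mM meta].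
have m0 : 0 < (m%:R : R) by rewrite ltr0n.
have {mM} mM : expR (M ^+ 2) <= m%:R.
  by apply: ltW; apply: (lt_le_trans (truncnS_gt _)); rewrite ler_nat.
have {meta} meta : (4 / eta ^+ 2) ^+ 2 <= m%:R.
  by apply: ltW; apply: (lt_le_trans (truncnS_gt _)); rewrite ler_nat.
split.
  apply: (@le_trans _ _ (Num.sqrt (M ^+ 2))).
    by rewrite sqrtr_sqr ler_norm.
  by apply: ler_wsqrtr; rewrite -(expRK (M ^+ 2)) ler_ln ?posrE ?expR_gt0.
have eta20 : 0 < eta ^+ 2 by rewrite exprn_gt0.
have q0 : 0 <= 4 / eta ^+ 2 by rewrite divr_ge0 // ltW.
have sm0 : 0 < Num.sqrt (m%:R : R) by rewrite sqrtr_gt0.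
have sm : 4 / eta ^+ 2 <= Num.sqrt (m%:R : R).
  by rewrite -(ger0_norm q0) -sqrtr_sqr ler_wsqrtr.
rewrite -(ger0_norm (ltW eta0)) -sqrtr_sqr ler_wsqrtr // ler_pdivrMr //.
have mE : (m%:R : R) = Num.sqrt m%:R * Num.sqrt m%:R.
  by rewrite -expr2 sqr_sqrtr // ltW.
have -> : ln (m%:R : R) = 2 * ln (Num.sqrt (m%:R : R)).
  by rewrite {1}mE lnM ?posrE //; ring.
have h1 : ln (Num.sqrt (m%:R : R)) <= Num.sqrt m%:R.
  have := le_ln1Dx (_ : -1 < Num.sqrt (m%:R : R) - 1); rewrite addrCA subrr addr0.
  by move=> /(_ _)/le_trans; apply; lra.
have h2 : 4 <= eta ^+ 2 * Num.sqrt m%:R by move: sm; rewrite ler_pdivrMr // mulrC.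
have := ler_wpM2r (ltW sm0) h2; rewrite -mulrA -mE; lra.
Qed.

Theorem theorem2p3 (R : realType) (c : R) (G : nat -> finGroupType)
    (hc : 0 < c)
    (hG : #|G k| @[k --> \oo] --> \oo)
    (hf : forall eps : R, 0 < eps ->
       dep_f_sum (G k) (c + eps) @[k --> \oo] --> (0 : R)) :
  forall eps : R, 0 < eps ->
    cayley_prob (Num.sqrt ((c + eps) * ln (#|G k|%:R) / #|G k|%:R))
      (fun r : rel (G k) => (diameter R r <= 2%:E)%E) @[k --> \oo] --> (1 : R).
Proof.
move=> eps eps0.
(* Three exponents: the hypothesis is used at [a], the gap from [a] to [b] pays for the comparison
   with [dep_f], and the gap from [b] to [c2] pays for the factor 1 - 24 p. *)
pose a := c + eps / 2; pose b := c + 3 / 4 * eps; pose c2 := c + eps.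
have a0 : 0 < a by rewrite /a; lra.
have b0 : 0 < b by rewrite /b; lra.
have c20 : 0 < c2 by rewrite /c2; lra.
pose d := b - a; have d0 : 0 < d by rewrite /d /a /b; lra.
pose tau := d / (40 * a + d).
have tau0 : 0 < tau by rewrite divr_gt0 //; lra.
have sbc : Num.sqrt b < Num.sqrt c2 by rewrite ltr_sqrt // /b /c2; lra.
have sb0 : 0 < Num.sqrt b by rewrite sqrtr_gt0.
have sc0 : 0 < Num.sqrt c2 by rewrite sqrtr_gt0.
have sa0 : 0 < Num.sqrt a by rewrite sqrtr_gt0.
apply/cvgrPdist_le => r r0.
pose K := `|ln (4 / tau)|.
(* The summands of [M] yield [sl1], [l1], [l2] and [l3] in turn; the terms of [eta] yield [n_large],
   [sb] and [bp]. *)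
pose M := 1 + 4 * Num.sqrt a / d + 4 * (2 * Num.sqrt a + K) / d + 16 / (d * r).
pose eta := Num.min (tau / 8) (Num.min (Num.sqrt b * tau / (1 / 2 + d / 4))
   ((Num.sqrt c2 - Num.sqrt b) / (24 * c2))).
have eta0 : 0 < eta.
  rewrite !lt_min; apply/and3P; split; apply: divr_gt0 => //.
  - exact: mulr_gt0.
  - lra.
  - by rewrite subr_gt0.
  - by rewrite mulr_gt0.
have [N HN] := sqrt_ln_large M eta0.
have hfa : dep_f_sum (G k) a @[k --> \oo] --> (0 : R) by apply: hf; rewrite divr_gt0.
have hr : 0 < Num.min 1 (r / 2) by rewrite lt_min ltr01 divr_gt0.
have /cvgrPdist_le /(_ _ hr) hfr := hfa.
have hN : \forall k \near \oo, (N <= #|G k|)%N by exact: (hG _ (nbhs_infty_ge N)).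
near=> k.
have Nk : (N <= #|G k|)%N by near: k.
have : `|0 - dep_f_sum (G k) a| <= Num.min 1 (r / 2) by near: k.
rewrite sub0r normrN => /(le_trans (ler_norm _)); rewrite le_min => /andP[f1 fr].
have [Ml seta] := HN _ Nk.
set n := #|G k|%:R in Ml seta *; set l := ln n in Ml seta *.
set s := Num.sqrt (l / n) in seta *.
have [d0' sa0' r0'] := And3 (ltW d0) (ltW sa0) (ltW r0).
have K0 : 0 <= K by exact: normr_ge0.
have M1 : 0 <= 4 * Num.sqrt a / d by rewrite divr_ge0 ?mulr_ge0.
have M2 : 0 <= 4 * (2 * Num.sqrt a + K) / d.
  by rewrite divr_ge0 // mulr_ge0 // addr_ge0 // mulr_ge0.
have M3 : 0 <= 16 / (d * r) by rewrite divr_ge0 ?mulr_ge0.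
have sl1 : 1 <= Num.sqrt l by rewrite /M in Ml; lra.
have l0 : 0 < l by rewrite -sqrtr_gt0; lra.
have lE : l = Num.sqrt l * Num.sqrt l by rewrite -expr2 sqr_sqrtr // ltW.
have n0 : 0 < n by exact: natr_card_gt0.
have s0 : 0 <= s by exact: sqrtr_ge0.
move: seta; rewrite !le_min => /and3P[s1 s2 s3].
have n_large : 8 * Num.sqrt n <= tau * n.
  have := sqrt_ln_div_card R (G k); rewrite -/n -/l -/s => sE.
  have := sqr_sqrt_card R (G k); rewrite -/n => nE.
  have sn0 : 0 <= Num.sqrt n by exact: sqrtr_ge0.
  rewrite -[in leRHS]nE mulrA; apply: ler_wpM2r => //.
  have : s * Num.sqrt n <= tau / 8 * Num.sqrt n by apply: ler_wpM2r.
  rewrite sE; lra.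
have l1 : 4 * Num.sqrt a <= d * Num.sqrt l.
  rewrite -ler_pdivrMl // mulrC; rewrite /M in Ml; lra.
have l2 : 2 * Num.sqrt a * Num.sqrt l + ln (4 / tau) <= d / 4 * l.
  have lnK : ln (4 / tau) <= K by exact: ler_norm.
  have : 4 * (2 * Num.sqrt a + K) <= d * Num.sqrt l.
    rewrite -ler_pdivrMl // mulrC; rewrite /M in Ml; lra.
  move=> /(ler_wpM2r (sqrtr_ge0 l)); rewrite -[leRHS]mulrA -lE.
  have : K <= K * Num.sqrt l by rewrite ler_peMr.
  nra.
have l3 : 16 <= d * r * l.
  have : 16 <= d * r * Num.sqrt l.
    rewrite -ler_pdivrMl ?mulr_gt0 // mulrC; rewrite /M in Ml; lra.
  move/le_trans; apply; apply: ler_wpM2l; first by rewrite mulr_ge0.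
  by rewrite [leRHS]lE ler_peMr // sqrtr_ge0.
have sb : (1 / 2 + d / 4) * s <= Num.sqrt b * tau.
  by move: s2; rewrite ler_pdivlMr 1?mulrC //; lra.
set p := Num.sqrt _.
have pE : p = Num.sqrt c2 * s by rewrite /p -/c2 -mulrA sqrtrM // ltW.
have bp : Num.sqrt b <= (1 - 24 * p) * Num.sqrt c2.
  have c2E : c2 = Num.sqrt c2 * Num.sqrt c2 by rewrite -expr2 sqr_sqrtr // ltW.
  have : s * (24 * (Num.sqrt c2 * Num.sqrt c2)) <= Num.sqrt c2 - Num.sqrt b.
    by rewrite -c2E -ler_pdivlMr ?mulr_gt0.
  by rewrite pE; lra.
have p01 : 0 <= p <= 1.
  rewrite sqrtr_ge0 /=; have : 0 < 1 - 24 * p.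
    by rewrite ltNge; apply/negP => h; have := mulr_le0_ge0 h (ltW sc0); lra.
  lra.
have ge := cayley_prob_diameter_ge (G k) p01.
have le := cayley_prob_le1 p01 (fun r : rel (G k) => (diameter R r <= 2%:E)%E).
rewrite ger0_norm ?subr_ge0 // lerBlDr -lerBlDl.
apply: le_trans ge; rewrite lerD2l lerN2.
apply: (@le_trans _ _ (\sum_(x : G k | x != 1%g) independence_bound b x)).
  by apply: ler_sum => x _; apply: pr_le_independence_bound => //; exact: ltW.
apply: (le_trans (sum_independence_bound a0 d0 f1 n_large l2 l1 l0 sb)).
(* The error [r] is split evenly: r/2 for the sum of [dep_f], and r/2 for twice this exponential. *)
have ex : expR (- (d / 4 * l)) <= r / 4.
  rewrite expRN.
  have t0 : 0 < 4 / r by rewrite divr_gt0.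
  have -> : r / 4 = (4 / r)^-1 by rewrite invf_div.
  rewrite lef_pV2 ?posrE ?expR_gt0 //.
  apply: le_trans (expR_ge1Dx _).
  rewrite ler_pdivrMr // mulrDl mul1r; lra.
rewrite -/d -/l; lra.
Unshelve. all: by end_near.
Qed.
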